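(* Let $K\subset\mathbb R^2$ be an origin-symmetric convex body with boundary of class $C^2$, and let $\delta_*=\frac12\mathrm{Vol}_2(K)$. If $\Gamma_{\delta_*}(K)$ is homothetic to $\mathcal I^*K$, then $K$ is an ellipse.
   Context: A convex body is a compact convex set with non-empty interior. For each unit vector $\boldsymbol\xi$ let $H_{\boldsymbol\xi}$ be the line orthogonal to $\boldsymbol\xi$ such that the half-plane $H_{\boldsymbol\xi}^-$ cuts off from $K$ area exactly $\delta_*$ (for symmetric $K$ these are the lines through the origin); $\Gamma_{\delta_*}(K)$ is the locus of the centroids of $K\cap H_{\boldsymbol\xi}^-$. The intersection body $\mathcal IK$ of $K$ is the star body with radial function $\rho_{\mathcal IK}(\boldsymbol\xi)=\mathrm{Vol}_1(K\cap\boldsymbol\xi^\perp)$, and $\mathcal I^*K=(\mathcal IK)^*$ is its polar body, with support function $h_{\mathcal I^*K}=1/\rho_{\mathcal IK}$. Two curves/bodies are homothetic if one is the image of the other under a map $x\mapsto q+\lambda(x-q)$ with $\lambda>0$. *)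

(* Defs.v *)
From HB Require Import structures.
From mathcomp Require Import all_boot all_order all_algebra.
From mathcomp Require Import all_classical all_reals all_analysis.
Import Order.TTheory GRing.Theory Num.Theory.
Import numFieldNormedType.Exports.
Set Implicit Arguments. Unset Strict Implicit. Unset Printing Implicit Defensive.
Local Open Scope classical_set_scope.
Local Open Scope ring_scope.

Definition dot {R : realType} (x y : R * R) : R := x.1 * y.1 + x.2 * y.2.

Definition unitv {R : realType} (u : R * R) : Prop := dot u u = 1.

Definition perp {R : realType} (u : R * R) : R * R := (- u.2, u.1).

Definition area {R : realType} (A : set (R * R)) : \bar R :=
  ((@lebesgue_measure R) \x (@lebesgue_measure R))%E A.

Definition convex_set2 {R : realType} (K : set (R * R)) : Prop :=
  forall x y t, K x -> K y -> 0 <= t <= 1 ->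
    K (t * x.1 + (1 - t) * y.1, t * x.2 + (1 - t) * y.2).

Definition convex_body {R : realType} (K : set (R * R)) : Prop :=
  compact K /\ convex_set2 K /\ (interior K !=set0).

Definition origin_symmetric {R : realType} (K : set (R * R)) : Prop :=
  forall x, K x -> K (- x.1, - x.2).

Definition bd {R : realType} (A : set (R * R)) : set (R * R) :=
  closure A `\` interior A.

(* boundary of class C^2: near each boundary point p, after a rotation
   (given by a unit vector u), K is the subgraph {x | x.u <= f(x.u^perp)}
   of a C^2 function f : R -> R. *)
Definition C2_function {R : realType} (f : R -> R) : Prop :=
  (forall s, derivable f s 1) /\ (forall s, derivable (derive1 f) s 1) /\
  continuous (derive1 (derive1 f)).

Definition C2_boundary {R : realType} (K : set (R * R)) : Prop :=
  forall p, bd K p ->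
    exists (u : R * R) (r : R) (f : R -> R),
      [/\ unitv u, 0 < r, C2_function f &
        K `&` ball p r = [set x | ball p r x /\ dot x u <= f (dot x (perp u))]].

Definition centroid {R : realType} (A : set (R * R)) : R * R :=
  let mu := ((@lebesgue_measure R) \x (@lebesgue_measure R))%E in
  (fine (\int[mu]_(x in A) (x.1)%:E)%E / fine (area A),
   fine (\int[mu]_(x in A) (x.2)%:E)%E / fine (area A)).

Definition delta_star {R : realType} (K : set (R * R)) : R := fine (area K) / 2.

Definition Gamma {R : realType} (delta : R) (K : set (R * R)) : set (R * R) :=
  [set c | exists (xi : R * R) (t : R),
     [/\ unitv xi, area (K `&` [set x | dot x xi <= t]) = delta%:E &
         c = centroid (K `&` [set x | dot x xi <= t])]].

(* radial function of the intersection body: length of the chord K cap xi^perp *)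
Definition rho_I {R : realType} (K : set (R * R)) (xi : R * R) : R :=
  fine (@lebesgue_measure R [set s : R | K (s * (perp xi).1, s * (perp xi).2)]).

Definition intersection_body {R : realType} (K : set (R * R)) : set (R * R) :=
  [set x | exists (r : R) (xi : R * R),
     [/\ unitv xi, 0 <= r <= rho_I K xi & x = (r * xi.1, r * xi.2)]].

Definition polar {R : realType} (L : set (R * R)) : set (R * R) :=
  [set y | forall x, L x -> dot x y <= 1].

Definition Istar {R : realType} (K : set (R * R)) : set (R * R) :=
  polar (intersection_body K).

Definition homothetic {R : realType} (A B : set (R * R)) : Prop :=
  exists (q : R * R) (lam : R), 0 < lam /\
    A = [set (q.1 + lam * (x.1 - q.1), q.2 + lam * (x.2 - q.2)) | x in B].

Definition is_ellipse {R : realType} (K : set (R * R)) : Prop :=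
  exists (c : R * R) (a b c' d : R), a * d - b * c' != 0 /\
    K = [set (c.1 + (a * x.1 + b * x.2), c.2 + (c' * x.1 + d * x.2)) |
          x in [set x : R * R | x.1 ^+ 2 + x.2 ^+ 2 <= 1]].

(* Main.v *)
Require Import Defs.
From HB Require Import structures.
From mathcomp Require Import all_boot all_order all_algebra.
From mathcomp Require Import all_classical all_reals all_analysis.
From mathcomp Require Import measurable_realfun ring lra.

(* Both curves are compared through their support values.  The half of [K] on
   the positive side of [v] maximizes the integral of [x . v] over subsets of
   [K]; hence this maximum [M v], divided by half the area of [K], is the
   support value of the curve of centroids.  In the plane the intersection body
   is [2 K] turned by a right angle, so the support value of its polar is
   [1 / (2 r w)], where [r] is the radial function of [K] and [w] is [v] turned
   by a right angle.  Homothety thus says that [M v * r w] is constant.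

   Restrict to [v = (s, -1)] and [w = (1, s)].  By the same maximality the
   integral [N s] of the abscissa over the half is a subgradient of [M], and an
   increment of [N] is an integral over a thin double sector around the line of
   slope [s], whence [M'' = N' = (2 / 3) r ^ 3 = C / M ^ 3].  Along solutions of
   this equation [M' ^ 2 + C / M ^ 2] is constant and equal to [(M ^ 2)'' / 2],
   so [M ^ 2], hence [1 / r ^ 2], is a quadratic polynomial in [s].  Off the
   axis [x.1 = 0], then, [K] is a sublevel set of a quadratic form, which
   boundedness makes definite; and closed convex sets with a common point off
   a line are equal as soon as they agree off that line. *)

Import Order.TTheory GRing.Theory Num.Theory.
Import numFieldNormedType.Exports.
Set Implicit Arguments.
Unset Strict Implicit.
Unset Printing Implicit Defensive.
Local Open Scope classical_set_scope.
Local Open Scope ring_scope.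

Section derivatives.
Context {R : realType}.
Implicit Types f F : R -> R.

Lemma is_derive_increment_bounds F f x :
  (forall s t, s < t -> exists m M, [/\ s <= m <= t, s <= M <= t &
    f m * (t - s) <= F t - F s <= f M * (t - s)]) ->
  {for x, continuous f} -> is_derive x 1 F (f x).
Proof.
move=> Ff cf; have Fx : h^-1 *: (F (h *: 1 + x) - F x) @[h --> 0^'] --> f x.
  apply/cvgrPdist_le => e e0.
  have /cvgrPdist_le/(_ _ e0)[d /= d0 fe] := cf.
  have Ffe s t : s < t -> (forall m, s <= m <= t -> `|x - m| < d) ->
      (f x - e) * (t - s) <= F t - F s <= (f x + e) * (t - s).
    move=> st std.
    have [m [M [/std/fe fm /std/fe fM /andP[lo up]]]] := Ff _ _ st.
    move: fm fM; rewrite !ler_distlC => /andP[fm _] /andP[_ fM].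
    by rewrite (le_trans _ lo) ?(le_trans up) ?ler_pM2r ?subr_gt0.
  exists d => // h /=; rewrite sub0r normrN => hd h0.
  rewrite /GRing.scale /= mulr1 (addrC h) ler_distlC.
  have [h_gt0|h_lt0|hE] := ltgtP 0 h; last by rewrite -hE eqxx in h0.
  - rewrite ler_pdivlMl// ler_pdivrMl// !(mulrC h).
    have := Ffe x (x + h); rewrite addrAC subrr add0r ltrDl; apply=> // m mxh.
    by rewrite ltr_distlC; move: hd; rewrite gtr0_norm//; lra.
  - rewrite ler_ndivlMl// ler_ndivrMl// !(mulrC h).
    have : (f x - e) * - h <= F x - F (x + h) <= (f x + e) * - h; last by lra.
    have := Ffe (x + h) x; rewrite opprD addrA subrr sub0r gtrDl.
    apply=> // m mxh.
    by rewrite ltr_distlC; move: hd; rewrite ltr0_norm//; lra.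
by apply: DeriveDef; [exact: cvgP Fx|exact: cvg_lim Fx].
Qed.

Definition subgradient F f : Prop :=
  forall s t, f s * (t - s) <= F t - F s.

Lemma subgradient_is_derive F f x : subgradient F f ->
  {for x, continuous f} -> is_derive x 1 F (f x).
Proof.
move=> Ff; apply: is_derive_increment_bounds => s t st.
exists s, t; rewrite !lexx ltW//; split=> //.
by apply/andP; split; [exact: Ff|have := Ff t s; lra].
Qed.

Lemma bounded_subgradient_continuous F f (C : R) : subgradient F f ->
  (forall s, `|f s| <= C) -> continuous F.
Proof.
move=> Ff fC; have C0 : 0 <= C := le_trans (normr_ge0 _) (fC 0).
have lipschitz s t : F s - F t <= C * `|s - t|.
  have := Ff s t; rewrite -lerN2 opprB => /le_trans; apply.
  by rewrite -mulrN opprB (le_trans (ler_norm _))// normrM ler_wpM2r.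
move=> s; apply/cvgrPdist_lt => e e0; exists (e / (C + 1)) => /=.
  by rewrite divr_gt0// ltr_wpDl.
move=> t /=; rewrite ltr_pdivlMr ?ltr_wpDl// mulrC => st.
apply: (@le_lt_trans _ _ (C * `|s - t|)).
  by rewrite ler_norml lerNl opprB lipschitz distrC lipschitz.
by apply: le_lt_trans st; rewrite ler_wpM2r// lerDl.
Qed.

(* The energy [f' ^ 2 + C / f ^ 2] is conserved, and [(f ^ 2)''] is twice it. *)
Lemma ermakov_square_quadratic f f' (C : R) : (forall s, f s != 0) ->
  (forall s : R, is_derive s 1 f (f' s)) ->
  (forall s : R, is_derive s 1 f' (C / f s ^+ 3)) ->
  exists a b c, forall s, f s ^+ 2 = a * s ^+ 2 + b * s + c.
Proof.
move=> f0 df df'.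
have const (g : R -> R) : (forall s : R, is_derive s 1 g 0) ->
    forall s, g s = g 0.
  by move=> dg s; exact: is_derive_0_is_cst.
pose energy s := f' s ^+ 2 + C * (f s)^-1 ^+ 2.
have energyE s : energy s = energy 0.
  apply: const => t; have df1 := is_deriveV (f0 t) (df t).
  rewrite (_ : energy = f' ^+ 2 + C \*: (fun y => (f y)^-1) ^+ 2)//.
  by apply: is_derive_eq; rewrite /GRing.scale /= expr1; field.
pose a := energy 0; pose slope s := 2 * (f s * f' s) - 2 * a * s.
have slopeE s : slope s = slope 0.
  apply: const => t; rewrite (_ : slope = 2 \*: (f * f') - (2 * a) \*: id)//.
  apply: is_derive_eq; rewrite /GRing.scale /= /a -(energyE t) /energy.
  by field.
pose b := slope 0; pose rest s := f s ^+ 2 - a * s ^+ 2 - b * s.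
have restE s : rest s = rest 0.
  apply: const => t; rewrite (_ : rest = f ^+ 2 - a \*: id ^+ 2 - b \*: id)//.
  apply: is_derive_eq; rewrite /GRing.scale /= /b -(slopeE t) /slope expr1.
  by ring.
by exists a, b, (rest 0) => s; rewrite -(restE s) /rest; ring.
Qed.

End derivatives.

Section support_values.
Context {R : realType}.
Implicit Types (A L C K : set (R * R)) (v w x y p q : R * R).

Definition support_value A v (m : R) : Prop :=
  (exists2 c, A c & dot c v = m) /\ forall c, A c -> dot c v <= m.

Lemma scale_pairE (t : R) x : t *: x = (t * x.1, t * x.2).
Proof. by []. Qed.

Lemma dotC x y : dot x y = dot y x.
Proof. by rewrite /dot mulrC [x.2 * _]mulrC. Qed.

Lemma dotDl x y v : dot (x + y) v = dot x v + dot y v.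
Proof. by rewrite /dot /=; ring. Qed.

Lemma dotZl (t : R) x v : dot (t *: x) v = t * dot x v.
Proof. by rewrite scale_pairE /dot /=; ring. Qed.

Lemma dotZr (t : R) x v : dot x (t *: v) = t * dot x v.
Proof. by rewrite dotC dotZl dotC. Qed.

Lemma dotNl x v : dot (- x) v = - dot x v.
Proof. by rewrite /dot /=; ring. Qed.

Lemma dotNr x v : dot x (- v) = - dot x v.
Proof. by rewrite dotC dotNl dotC. Qed.

Lemma dot_gt0 v : v != 0 -> 0 < dot v v.
Proof.
case: v => v1 v2; rewrite xpair_eqE negb_and /dot /= -!expr2 => v0.
by case/orP: v0 => vi0; [apply: ltr_pwDl|apply: ltr_wpDl];
  rewrite ?sqr_ge0// lt_neqAle eq_sym sqrf_eq0 vi0 sqr_ge0.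
Qed.

Lemma dot_continuous v : continuous (fun x => dot x v).
Proof.
move=> x; apply: cvgD; apply: cvgM;
  [exact: cvg_fst|exact: cvg_cst|exact: cvg_snd|exact: cvg_cst].
Qed.

Lemma perpN v : perp (- v) = - perp v.
Proof. by []. Qed.

Lemma perpZ (t : R) v : perp (t *: v) = t *: perp v.
Proof. by rewrite !scale_pairE /perp /= mulrN. Qed.

Lemma perp_neq0 v : v != 0 -> perp v != 0.
Proof. by case: v => v1 v2; rewrite !xpair_eqE oppr_eq0 andbC. Qed.

Lemma slope_neq0 (m : R) : (1, m) != 0 :> R * R.
Proof. by rewrite xpair_eqE oner_eq0. Qed.

Lemma perp_decomposition p x : p != 0 ->
  x = (dot x p / dot p p) *: p + (dot x (perp p) / dot p p) *: perp p.
Proof.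
move=> /dot_gt0/lt0r_neq0; case: p x => [p1 p2] [x1 x2].
rewrite /dot /perp /= => n0.
by rewrite !scale_pairE; congr pair => /=; field.
Qed.

Lemma unitv_neq0 v : unitv v -> v != 0.
Proof.
apply: contra_eq_neq => ->; rewrite /dot !mul0r addr0 eq_sym.
exact: oner_neq0.
Qed.

Lemma unitv_normalize v : v != 0 ->
  exists2 n : R, 0 < n & unitv (n^-1 *: v).
Proof.
move=> /dot_gt0 vv; exists (Num.sqrt (dot v v)); first by rewrite sqrtr_gt0.
rewrite /unitv dotZl dotZr mulrA -expr2 exprVn sqr_sqrtr ?ltW//.
by rewrite mulVf ?gt_eqF.
Qed.

Lemma support_value_unique A v m n :
  support_value A v m -> support_value A v n -> m = n.
Proof.
move=> [[c Ac cm] Am] [[d Ad dn] An]; apply/eqP; rewrite eq_le.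
by rewrite -{1}cm An// -dn Am.
Qed.

Lemma homothetic_support_value A B : homothetic A B ->
  exists q, exists2 lam : R, 0 < lam &
    forall v m, support_value B v m ->
      support_value A v ((1 - lam) * dot q v + lam * m).
Proof.
move=> [q [lam [lam0 ->]]]; exists q, lam => // v m [[c Bc cm] Bm].
have dotE x : dot (q.1 + lam * (x.1 - q.1), q.2 + lam * (x.2 - q.2)) v =
    (1 - lam) * dot q v + lam * dot x v by rewrite /dot /=; ring.
split=> [|_ [x Bx <-]]; last by rewrite dotE lerD2l ler_pM2l// Bm.
eexists; first by exists c; [exact: Bc|reflexivity].
by rewrite dotE cm.
Qed.

Lemma nbhs_ray x v (U : set (R * R)) : nbhs x U ->
  exists2 t : R, 0 < t & U (x + t *: v).
Proof.
move=> xU; have /cvg_at_right_filter xtv : x + t *: v @[t --> (0 : R)] --> x.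
  rewrite -[X in _ --> X]addr0 -[X in _ + X](scale0r v).
  by apply: cvgD; [exact: cvg_cst|apply: cvgZr_tmp; exact: cvg_id].
have [t [t0 Ut]] : exists t : R, 0 < t /\ U (x + t *: v).
  apply: (@filter_ex _ (0 : R)^'+); apply: filterI; last exact: xtv.
  exact: nbhs_right_gt.
by exists t.
Qed.

Lemma bd_support_value A v m : closed A -> v != 0 -> support_value A v m ->
  support_value (bd A) v m.
Proof.
move=> clA v0 [[c Ac cm] Am].
split=> [|x [/clA/Am]//]; exists c => //; split; first exact: subset_closure.
move=> /(nbhs_ray v)[t t0 /Am]; rewrite dotDl dotZl cm gerDl leNgt.
by rewrite mulr_gt0// dot_gt0.
Qed.

(* [c] separates the slopes at [(m, 0)] of the chords to the two sides. *)
Lemma convex_set2_separation C (m : R) : convex_set2 C ->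
  (exists2 x, C x & x.2 < 0) -> (exists2 x, C x & 0 < x.2) ->
  (forall a, C (a, 0) -> a <= m) ->
  exists c : R, forall x, C x -> x.1 + c * x.2 <= m.
Proof.
move=> Cconv [p Cp p0] [q Cq q0] Cm.
have slope_le x z : C x -> C z -> x.2 < 0 -> 0 < z.2 ->
    (x.1 - m) / - x.2 <= (m - z.1) / z.2.
  move=> Cx Cz x0 z0; have zx0 : 0 < z.2 - x.2 by lra.
  have t01 : 0 <= z.2 / (z.2 - x.2) <= 1.
    by apply/andP; split; [rewrite divr_ge0 ?ltW|rewrite ler_pdivrMr//; lra].
  have /Cm : C ((z.2 * x.1 - x.2 * z.1) / (z.2 - x.2), 0).
    have := Cconv _ _ _ Cx Cz t01; congr C.
    by congr pair; field; rewrite gt_eqF.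
  rewrite ler_pdivrMr// => crossing.
  by rewrite ler_pdivrMr ?oppr_gt0// mulrAC ler_pdivlMr//; lra.
pose S := [set (x.1 - m) / - x.2 | x in [set x | C x /\ x.2 < 0]].
have Sub z : C z -> 0 < z.2 -> ubound S ((m - z.1) / z.2).
  by move=> Cz z0 _ [x [Cx x0] <-]; exact: slope_le.
exists (sup S) => x Cx; have [x0|x0|x0] := ltgtP x.2 0.
- have : (x.1 - m) / - x.2 <= sup S.
    by apply: ub_le_sup; [exists ((m - q.1) / q.2); exact: Sub|exists x].
  by rewrite ler_pdivrMr ?oppr_gt0//; lra.
- have : sup S <= (m - x.1) / x.2.
    by apply: ge_sup; [exists ((p.1 - m) / - p.2), p|exact: Sub].
  by rewrite ler_pdivlMr//; lra.
- by rewrite x0 mulr0 addr0; apply: Cm; rewrite -x0 -surjective_pairing.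
Qed.

Lemma convex_set2_supporting_line K p :
  convex_set2 K -> nbhs (0 : R * R) K -> p != 0 ->
  (forall a, K (a *: p) -> a <= 1) ->
  exists2 y, dot p y = 1 & forall x, K x -> dot x y <= 1.
Proof.
move=> Kconv K0 p0 Kp.
pose C := [set z | K (z.1 *: p + z.2 *: perp p)].
have [c Cc] : exists c : R, forall z, C z -> z.1 + c * z.2 <= 1.
  apply: convex_set2_separation.
  - move=> x z t Kx Kz /(Kconv _ _ _ Kx Kz); congr K.
    by rewrite !scale_pairE; congr pair => /=; ring.
  - have [t t0] := nbhs_ray (- perp p) K0; rewrite add0r scalerN -scaleNr => Kt.
    by exists (0, - t); rewrite /C /= ?scale0r ?add0r ?oppr_lt0.
  - have [t t0] := nbhs_ray (perp p) K0; rewrite add0r => Kt.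
    by exists (0, t); rewrite /C /= ?scale0r ?add0r.
  - by move=> a; rewrite /C /= scale0r addr0; exact: Kp.
have n0 := lt0r_neq0 (dot_gt0 p0).
have yE x : dot x ((dot p p)^-1 *: (p + c *: perp p)) =
    dot x p / dot p p + c * (dot x (perp p) / dot p p).
  by rewrite dotC dotZl dotDl dotZl !(dotC _ x); ring.
exists ((dot p p)^-1 *: (p + c *: perp p)).
  rewrite yE divff// (_ : dot p (perp p) = 0) ?mul0r ?mulr0 ?addr0//.
  by rewrite /dot /=; ring.
move=> x Kx; rewrite yE; apply: (Cc (_, _)).
by rewrite /C /= -perp_decomposition.
Qed.

Lemma polar_closed L : closed (polar L).
Proof.
rewrite (_ : polar L = \bigcap_(x in L) [set y | dot y x <= 1]).
  apply: closed_bigI => x _; apply: preimage_closed (@closed_le _ 1).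
  by move=> y _; exact: dot_continuous.
by apply/seteqP; split=> y Ly x /Ly; rewrite /= dotC.
Qed.

Lemma polar_support_value L v (r : R) :
  convex_set2 L -> nbhs (0 : R * R) L -> v != 0 -> 0 < r ->
  L (r *: v) -> (forall a, L (a *: v) -> a <= r) ->
  support_value (polar L) v r^-1.
Proof.
move=> Lconv L0 v0 r0 Lr Lv; split=> [|y /(_ _ Lr)]; last first.
  by rewrite dotZl dotC -[r^-1]mul1r ler_pdivlMr// mulrC.
have [|a|y vy Ly] := convex_set2_supporting_line (p := r *: v) Lconv L0.
- by rewrite scaler_eq0 negb_or lt0r_neq0.
- by rewrite scalerA => /Lv; rewrite ger_pMl.
exists y => //; apply: (mulfI (lt0r_neq0 r0)).
by rewrite mulfV ?lt0r_neq0// dotC -dotZl.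
Qed.

End support_values.

Definition radial {R : realType} (K : set (R * R)) (v : R * R) : R :=
  sup [set s | K (s *: v)].

Section symmetric_bodies.
Context {R : realType} (K : set (R * R)).
Hypothesis Kbody : convex_body K.
Hypothesis Ksym : origin_symmetric K.
Implicit Types v x y : R * R.

Lemma body_closed : closed K.
Proof. by apply: compact_closed; [exact: norm_hausdorff|case: Kbody]. Qed.

Lemma body_bounded : exists2 M : R, 0 < M & forall x, K x -> `|x| <= M.
Proof.
have [/compact_bounded[M [_ KM]] _] := Kbody.
exists (`|M| + 1); first by rewrite ltr_wpDl.
by apply: KM; rewrite (le_lt_trans (ler_norm M))// ltrDl.
Qed.

Lemma body_nbhs0 : nbhs (0 : R * R) K.
Proof.
have [_ [Kconv [p Kp]]] := Kbody.
have pK : \forall x \near (0 : R * R), K (p + x) /\ K (p - x).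
  have addp : p + x @[x --> (0 : R * R)] --> p + 0.
    by apply: cvgD; [exact: cvg_cst|exact: cvg_id].
  have subp : p - x @[x --> (0 : R * R)] --> p - 0.
    by apply: cvgB; [exact: cvg_cst|exact: cvg_id].
  rewrite addr0 in addp; rewrite subr0 in subp.
  by apply: filterI; [exact: addp|exact: subp].
apply: filterS pK => x [Kpx /Ksym Kxp].
have := Kconv _ _ 2^-1 Kpx Kxp ltac:(lra); congr K.
by rewrite [RHS]surjective_pairing; congr pair => /=; field.
Qed.

Lemma body_balanced x (t : R) : K x -> `|t| <= 1 -> K (t *: x).
Proof.
have [_ [Kconv _]] := Kbody; rewrite ler_norml => Kx /andP[t1 t2].
have := Kconv _ _ ((1 + t) / 2) Kx (Ksym Kx) ltac:(lra); congr K.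
by rewrite scale_pairE; congr pair => /=; field.
Qed.

Lemma radialP v : v != 0 -> 0 < radial K v /\
  forall s, K (s *: v) <-> `|s| <= radial K v.
Proof.
move=> v0; pose S := [set s | K (s *: v)].
have [e e0 Se] : exists2 e, 0 < e & S e.
  by have [e e0] := nbhs_ray v body_nbhs0; rewrite add0r; exists e.
have Sub : has_ubound S.
  have [M M0 KM] := body_bounded.
  exists (M / `|v|) => s /KM; rewrite normrZ ler_pdivlMr ?normr_gt0//.
  by apply: le_trans; rewrite ler_wpM2r ?ler_norm.
have r0 : 0 < radial K v by apply: lt_le_trans e0 _; exact: ub_le_sup.
have Sr : S (radial K v).
  have Sclosed : closed S.
    apply: preimage_closed body_closed => s _.
    by apply: cvgZr_tmp; exact: cvg_id.
  by apply: Sclosed; apply: closure_sup => //; exists e.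
split=> // s; split=> [Ks|].
  rewrite ler_norml lerNl; apply/andP; split; apply: ub_le_sup => //.
  by move: Ks => /Ksym; rewrite /S /= scaleNr.
have := body_balanced (t := s / radial K v) Sr.
rewrite scalerA divfK ?gt_eqF// normf_div (gtr0_norm r0).
by rewrite ler_pdivrMr// mul1r.
Qed.

Lemma body_slopeP x : x.1 != 0 -> K x <-> `|x.1| <= radial K (1, x.2 / x.1).
Proof.
move=> x10; have [_ <-] := radialP (slope_neq0 (x.2 / x.1)).
by rewrite scale_pairE /= mulr1 mulrCA divff// mulr1 -surjective_pairing.
Qed.

Lemma radialN v : radial K (- v) = radial K v.
Proof.
by congr sup; apply/seteqP; split=> s /Ksym /=; rewrite ?scalerN ?opprK.
Qed.

Lemma radial_inv_sqr_coercive : exists2 e : R, 0 < e &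
  forall m, e * (1 + m ^+ 2) <= (radial K (1, m))^-1 ^+ 2.
Proof.
have [M M0 KM] := body_bounded.
exists (2 * M ^+ 2)^-1 => [|m]; first by rewrite invr_gt0 mulr_gt0// exprn_gt0.
have [r0 rE] := radialP (slope_neq0 m); pose z := M / radial K (1, m).
have [z1 zm] : 1 <= z /\ `|m| <= z.
  have /KM : K (radial K (1, m) *: (1, m)) by apply/rE; rewrite gtr0_norm.
  rewrite scale_pairE prod_normE /= ge_max mulr1 normrM (gtr0_norm r0).
  by move=> /andP[rM rmM]; rewrite !ler_pdivlMr// mul1r mulrC.
rewrite ler_pdivrMl ?mulr_gt0 ?exprn_gt0// -mulrA -exprMn -/z mulrDl !mul1r.
rewrite lerD ?exprn_ege1// -[m ^+ 2]real_normK ?num_real//.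
by rewrite lerXn2r ?nnegrE// (le_trans _ z1).
Qed.

Lemma rho_IE v : v != 0 -> rho_I K v = 2 * radial K (perp v).
Proof.
move=> /perp_neq0/radialP[r0 rE]; rewrite /rho_I.
rewrite (_ : [set s | _] = `[- radial K (perp v), radial K (perp v)]%classic).
  by rewrite lebesgue_measure_itv/= lte_fin ifT; [rewrite -EFinB/=; ring|lra].
by apply/seteqP; split=> s; rewrite /= in_itv /= -ler_norml => /rE.
Qed.

Lemma intersection_bodyE :
  intersection_body K = [set x | K (2^-1 *: perp x)].
Proof.
apply/seteqP; split=> [_ [r [v [/unitv_neq0 v0 /andP[r0 +] ->]]]|x Kx].
  rewrite rho_IE// => rv; have [_ rE] := radialP (perp_neq0 v0).
  rewrite /= -/(r *: v) perpZ scalerA; apply/rE.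
  by rewrite ger0_norm ?mulr_ge0//; lra.
have [->|x0] := eqVneq x 0.
  have e1 : unitv ((1, 0) : R * R) by rewrite /unitv /dot /= mul0r mul1r addr0.
  have [r0 _] := radialP (perp_neq0 (unitv_neq0 e1)).
  exists 0, (1, 0); split=> //; last by rewrite /= !mul0r.
  by rewrite rho_IE ?unitv_neq0// lexx mulr_ge0// ltW.
have [n n0 u1] := unitv_normalize x0.
have nx : x = n *: (n^-1 *: x) by rewrite scalerA divff ?gt_eqF ?scale1r.
exists n, (n^-1 *: x); split=> //.
have [_ rE] := radialP (perp_neq0 (unitv_neq0 u1)).
move: Kx; rewrite /= {1}nx perpZ scalerA => /rE.
by rewrite rho_IE ?unitv_neq0// (ltW n0)/= gtr0_norm ?mulr_gt0//; lra.
Qed.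

Lemma intersection_body_convex : convex_set2 (intersection_body K).
Proof.
have [_ [Kconv _]] := Kbody.
rewrite intersection_bodyE => x y t Kx Ky /(Kconv _ _ _ Kx Ky); congr K.
by rewrite !scale_pairE; congr pair => /=; ring.
Qed.

Lemma intersection_body_nbhs0 : nbhs (0 : R * R) (intersection_body K).
Proof.
have perp_cvg : perp x @[x --> (0 : R * R)] --> perp (0 : R * R).
  exact: (cvg_pair (cvgN cvg_snd) cvg_fst).
have : 2^-1 *: perp x @[x --> (0 : R * R)] --> 2^-1 *: perp (0 : R * R).
  exact: cvgZl_tmp.
rewrite (_ : perp 0 = 0) ?scaler0; last by congr pair; rewrite oppr0.
by rewrite intersection_bodyE; apply; exact: body_nbhs0.
Qed.

Lemma bd_Istar_support_value v : v != 0 ->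
  support_value (bd (Istar K)) v (2 * radial K (perp v))^-1.
Proof.
move=> v0; have [r0 rE] := radialP (perp_neq0 v0).
apply: bd_support_value => //; first exact: polar_closed.
apply: polar_support_value => //.
- exact: intersection_body_convex.
- exact: intersection_body_nbhs0.
- by rewrite mulr_gt0.
- rewrite intersection_bodyE /= perpZ scalerA mulKf//.
  by apply/rE; rewrite gtr0_norm.
- move=> a; rewrite intersection_bodyE /= perpZ scalerA => /rE.
  by move=> /(le_trans (ler_norm _)); lra.
Qed.

End symmetric_bodies.

(* [measurableTypeR R] and [R] carry the same measurable sets under different
   displays; Lebesgue measure lives on the former. *)
Local Notation plane R := (measurableTypeR R * measurableTypeR R)%type.
Local Notation mu := lebesgue_measure.
Local Notation mu2 := (lebesgue_measure \x lebesgue_measure)%E.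

Definition halfplane {R : realType} (v : R * R) : set (R * R) :=
  [set x | 0 <= dot x v].

(* The points whose slope [x.2 / x.1] lies between [s] and [t], up to the
   boundary. *)
Definition sector {R : realType} (s t : R) : set (R * R) :=
  halfplane (s, -1) `+` halfplane (t, -1).

Section Rintegral_subset.
Context d (T : measurableType d) (R : realType) (m : {measure set T -> \bar R}).
Implicit Types (D E S : set T) (f : T -> R).

Lemma integrable_patch D E f : measurable D -> measurable E ->
  m.-integrable D (EFin \o f) -> m.-integrable D (EFin \o (f \_ E)).
Proof.
move=> mD mE fD; rewrite -restrict_EFin; apply/integrable_restrict => //.
by apply: integrableS fD => //; exact: measurableI.
Qed.

Lemma Rintegral_le_nonneg_part D S f :
  measurable D -> measurable S -> S `<=` D -> m.-integrable D (EFin \o f) ->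
  \int[m]_(x in S) f x <= \int[m]_(x in D `&` [set x | 0 <= f x]) f x.
Proof.
move=> mD mS SD fD; set P := D `&` _.
have mP : measurable P.
  have /measurable_EFinP mf := measurable_int _ fD.
  rewrite /P (_ : [set x | _] = f @^-1` `[0, +oo[); first exact: mf.
  by apply/seteqP; split=> x; rewrite /= in_itv/= andbT.
have -> : \int[m]_(x in P) f x = \int[m]_(x in D `&` P) f x.
  by rewrite /P setIA setIid.
rewrite -(setIidr SD) !Rintegral_mkcondr.
apply: le_Rintegral => //; try exact: integrable_patch.
move=> x Dx; rewrite !patchE.
have [xS|xS] := boolP (x \in S); have [xP|xP] := boolP (x \in P) => //.
  by rewrite leNgt; apply: contra xP => /ltW f0; rewrite inE.
by move: xP; rewrite inE => -[].
Qed.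

End Rintegral_subset.

Section plane_measure.
Context {R : realType}.

Lemma open_measurable_plane (U : set (R * R)) :
  open U -> measurable (U : set (plane R)).
Proof.
move=> oU; pose W a b := [set y | forall x, x \in `]a, b[ -> U (x, y)].
have -> : U = \bigcup_a \bigcup_b
    (`](ratr a), (ratr b)[%classic `*` (W (ratr a) (ratr b))°).
  apply/seteqP; split=> [[x y] Uxy|[x y] [a _ [b _ [/= xab]]]]; last first.
    by move=> /interior_subset; apply.
  have : nbhs (x, y) U by exact: open_nbhs_nbhs.
  rewrite -nbhs_ballE => -[e /= e0 eU].
  have [a] : exists a : rat, ratr a \in `]x - e, x[ by apply: rat_in_itvoo; lra.
  have [b] : exists b : rat, ratr b \in `]x, x + e[ by apply: rat_in_itvoo; lra.
  rewrite !in_itv /= => /andP[xb bx] /andP[ax xa].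
  exists a => //; exists b => //; split; first by rewrite /= in_itv/= xa.
  exists e => // z yz t; rewrite in_itv/= => /andP[ta tb]; apply: eU.
  by split=> //=; rewrite /ball /= ltr_distlC; apply/andP; split; lra.
apply: bigcupT_measurable_rat => a; apply: bigcupT_measurable_rat => b.
apply: (@measurableX _ _ (measurableTypeR R) (measurableTypeR R)).
  exact: measurable_itv.
by apply: open_measurable; exact: open_interior.
Qed.

Lemma closed_measurable_plane (A : set (R * R)) :
  closed A -> measurable (A : set (plane R)).
Proof.
by move=> /closed_openC/open_measurable_plane/measurableC; rewrite setCK.
Qed.

Lemma continuous_measurable_plane (f : R * R -> R) :
  continuous f -> measurable_fun setT (f : plane R -> R).
Proof.
move=> /continuousP cf; apply: (measurability _ (RGenOInfty.measurableE R)).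
move=> _ [_ [a ->]] <-; rewrite setTI; apply: open_measurable_plane.
by apply: cf; exact: interval_open.
Qed.

Lemma measurable_dot_preimage (v : R * R) (A : set R) :
  closed A -> measurable (dot^~ v @^-1` A : set (plane R)).
Proof.
move=> clA; apply: closed_measurable_plane; apply: preimage_closed clA => x _.
exact: dot_continuous.
Qed.

Lemma measurable_halfplane (v : R * R) :
  measurable (halfplane v : set (plane R)).
Proof. exact: measurable_dot_preimage (@closed_ge _ 0). Qed.

Lemma in_halfplane (v x : R * R) : (x \in halfplane v) = (0 <= dot x v).
Proof. by apply/idP/idP; rewrite inE. Qed.

Lemma in_sector (s t : R) (x : R * R) :
  (x \in sector s t) = (0 <= dot x (s, -1)) (+) (0 <= dot x (t, -1)).
Proof.
apply/idP/idP; rewrite inE /sector /halfplane /setY /setU /setD /=.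
  by case=> -[-> /negP/negbTE ->].
by case: (0 <= _); case: (0 <= _) => //= _; [left|right].
Qed.

Lemma sector_slope (s t : R) (x : R * R) : s < t -> sector s t x ->
  x.1 != 0 /\ s <= x.2 / x.1 <= t.
Proof.
move=> st; rewrite -[sector s t x]in_setE in_sector /dot /=.
have [xs|xs] := leP 0 (x.1 * s + _);
  have [xt|xt] //= := leP 0 (x.1 * t + _) => _.
  have : 0 < - x.1 * (t - s) by lra.
  rewrite pmulr_lgt0 ?subr_gt0// oppr_gt0 => x1; split; first by rewrite lt_eqF.
  by rewrite ler_ndivlMr// ler_ndivrMr//; apply/andP; split; lra.
have : 0 < x.1 * (t - s) by lra.
rewrite pmulr_lgt0 ?subr_gt0// => x1; split; first by rewrite gt_eqF.
by rewrite ler_pdivlMr// ler_pdivrMr//; apply/andP; split; lra.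
Qed.

Lemma measurable_sector (s t : R) : measurable (sector s t : set (plane R)).
Proof.
by apply: measurableU; apply: measurableD; exact: measurable_halfplane.
Qed.

Lemma measurable_oppr_plane :
  @measurable_fun _ _ (plane R) (plane R) setT -%R.
Proof.
by apply: measurable_fun_pair; apply: measurableT_comp => //;
  exact: oppr_measurable.
Qed.

Lemma product_measure_oppr (A : set (plane R)) :
  measurable A -> pushforward mu2 (-%R : _ -> plane R) A = mu2 A.
Proof.
move=> mA; apply/esym; move: A mA.
apply: (@product_measure_unique _ _ (measurableTypeR R) (measurableTypeR R) R
  mu mu (pushforward mu2 (-%R : _ -> plane R))) => //.
  exact: measurable_oppr_plane.
move=> moppr X Y mX mY.
have mN (Z : set R) : measurable Z -> measurable (-%R @^-1` Z).
  by move=> mZ; rewrite -[X in measurable X]setTI; exact: oppr_measurable.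
have XE := lebesgue_measureN mX; have YE := lebesgue_measureN mY.
transitivity (pushforward mu (-%R : _ -> measurableTypeR R) X *
  pushforward mu (-%R : _ -> measurableTypeR R) Y)%E; last by rewrite XE YE.
by rewrite /pushforward -product_measure1E//; exact: mN.
Qed.

Lemma ge0_integral_oppr (D : set (plane R)) (f : R * R -> \bar R) :
  measurable D -> measurable_fun D (f : plane R -> \bar R) ->
  {in D, forall x, 0 <= f x}%E ->
  (\int[mu2]_(x in (-%R : _ -> plane R) @^-1` D) f (- x)%R =
   \int[mu2]_(x in D) f x)%E.
Proof.
move=> mD mf f0.
rewrite -(ge0_integral_pushforward measurable_oppr_plane mu2 mD mf f0).
apply: eq_measure_integral => [|moppr A mA _].
  exact: measurable_oppr_plane.
exact: product_measure_oppr.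
Qed.

Lemma measure_line (v : R * R) : v != 0 -> mu2 [set x | dot x v = 0] = 0%E.
Proof.
move=> v0; have [v20|v20] := eqVneq v.2 0.
  have -> : [set x : R * R | dot x v = 0] = [set 0] `*` setT.
    have v10 : v.1 != 0 by apply: contra v0; case: v v20 => v1 _ /= -> /eqP ->.
    apply/seteqP; split=> x; rewrite /dot /= v20 mulr0 addr0.
      by move=> /eqP; rewrite mulf_eq0 (negbTE v10) orbF => /eqP.
    by move=> [-> _]; rewrite mul0r.
  rewrite product_measure1E; [|exact: measurable_set1|exact: measurableT].
  by rewrite [X in (X * _)%E](lebesgue_measure_set1 0) mul0e.
rewrite /product_measure1 integral0_eq// => x _ /=.
rewrite (_ : xsection _ _ = [set - (x * v.1) / v.2]) ?lebesgue_measure_set1//.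
apply/seteqP; split=> y; rewrite /xsection /= inE /= /dot /=.
  by move=> xy; apply: (mulIf v20); rewrite mulfVK//; lra.
by move=> ->; rewrite mulfVK//; ring.
Qed.

Lemma lebesgue_measure_setY_ray (a b : R) :
  mu (`]-oo, a]%classic `+` `]-oo, b]%classic) = `|a - b|%:E.
Proof.
wlog ab : a b / a <= b => [H|].
  by have [|/ltW] := leP a b => /H //; rewrite setYC distrC.
rewrite ler0_norm ?subr_le0// opprB.
rewrite (_ : _ `+` _ = `]a, b]%classic).
  rewrite lebesgue_measure_itv /= lte_fin lt_neqAle ab andbT -EFinB.
  by case: eqP => [->|//]; rewrite subrr.
apply/seteqP; split=> y; rewrite /= !in_itv/=; last first.
  by move=> /andP[ay yb]; right; split=> //; apply/negP; rewrite -ltNge.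
case=> -[ya /negP]; rewrite -ltNge => yb; last by rewrite yb.
by move: (le_lt_trans ab yb); rewrite ltNge ya.
Qed.

Lemma integral_itv_sqr (k a : R) : 0 < a ->
  (\int[mu]_(x in `[(- a)%R, a]) (k * x ^+ 2)%:E = (2 / 3 * a ^+ 3 * k)%:E)%E.
Proof.
move=> a0; have aa : - a < a by lra.
pose F (x : R) := k / 3 * x ^+ 3.
have dF (x : R) : is_derive x 1 F (k * x ^+ 2).
  rewrite (_ : F = k / 3 \*: id ^+ 3)//.
  by apply: is_derive_eq; rewrite /GRing.scale /=; field.
have cF : continuous F.
  move=> x; apply/differentiable_continuous/derivable1_diffP.
  by have [] := dF x.
rewrite (@continuous_FTC2 _ _ F _ _ aa).
- by rewrite -EFinB; congr EFin; rewrite /F; field.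
- apply: continuous_subspaceT => x.
  by apply: cvgM; [exact: cvg_cst|exact: exprn_continuous].
- split=> [x _||]; first by have [] := dF x.
  + exact/cvg_at_right_filter/cF.
  + exact/cvg_at_left_filter/cF.
- by move=> x _; rewrite derive1E; have [_ ->] := dF x.
Qed.

Lemma measurable_strip (a : R) :
  measurable ([set x : R * R | `|x.1| <= a] : set (plane R)).
Proof.
apply: closed_measurable_plane.
apply: (@preimage_closed _ _ (fun x : R * R => `|x.1|) [set t | t <= a]).
  by move=> x _; apply: (@cvg_norm _ R); exact: cvg_fst.
exact: closed_le.
Qed.

Lemma integral_strip_sector (s t a : R) : 0 < a ->
  (\int[mu2]_(x in [set x : R * R | (`|x.1| <= a)%R] `&` sector s t) `|x.1|%:E =
   (2 / 3 * a ^+ 3 * `|s - t|)%:E)%E.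
Proof.
move=> a0; set D := _ `&` _.
have mD : measurable (D : set (plane R)).
  by apply: measurableI; [exact: measurable_strip|exact: measurable_sector].
have mf : measurable_fun setT ((fun x : plane R => `|x.1 : R|%:E) \_ D).
  apply/(measurable_restrictT _ mD)/measurable_EFinP/measurable_funTS.
  apply: (@continuous_measurable_plane (fun x => `|x.1|)).
  by move=> x; apply: (@cvg_norm _ R); exact: cvg_fst.
rewrite integral_mkcond fubini_tonelli1; [|exact: mf|]; last first.
  by move=> x; rewrite patchE; case: ifP.
rewrite -integral_itv_sqr// [RHS]integral_mkcond.
apply: eq_integral => x _.
rewrite /fubini_F [RHS]patchE mem_setE in_itv/= -ler_norml.
have [xa|xa] := boolP (`|x : R| <= a); last first.
  apply: integral0_eq => y _; rewrite patchE memNset// => -[/=].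
  by rewrite (negbTE xa).
pose I : set R := `]-oo, (x * s)%R]%classic `+` `]-oo, (x * t)%R]%classic.
have DI y : ((x, y) \in D) = (y \in I).
  have halfplaneE r : halfplane (r, -1) (x, y) = `]-oo, (x * r)%R]%classic y.
    by rewrite /halfplane /dot /= in_itv /= mulrN1 subr_ge0.
  apply/idP/idP; rewrite !inE /D /I /sector /setY /setD /setU /= !halfplaneE//.
  by case.
transitivity (\int[mu]_(y in I) `|x : R|%:E)%E.
  rewrite [RHS]integral_mkcond; apply: eq_integral => y _.
  by rewrite !patchE DI.
rewrite integral_cst; last by apply: measurableU; apply: measurableD.
rewrite [X in (_ * X)%E](lebesgue_measure_setY_ray (x * s) (x * t)).
by rewrite -mulrBr normrM -EFinM mulrA -expr2 real_normK ?num_real// mulrC.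
Qed.

End plane_measure.

Definition half_body {R : realType} (K : set (R * R)) (v : R * R) : set (R * R) :=
  K `&` halfplane v.

Definition half_moment {R : realType} (K : set (R * R)) (v : R * R) : R :=
  \int[mu2]_(x in half_body K v) dot x v.

Definition half_abscissa {R : realType} (K : set (R * R)) (v : R * R) : R :=
  \int[mu2]_(x in half_body K v) x.1.

Section half_bodies.
Context {R : realType} (K : set (R * R)).
Hypothesis Kbody : convex_body K.
Hypothesis Ksym : origin_symmetric K.
Implicit Types v x y : R * R.

Lemma measurable_body : measurable (K : set (plane R)).
Proof. exact: closed_measurable_plane (body_closed Kbody). Qed.

Lemma measurable_half_body v : measurable (half_body K v : set (plane R)).
Proof. exact: measurableI measurable_body (measurable_halfplane v). Qed.

Lemma half_body_subset v : half_body K v `<=` K.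
Proof. by move=> x []. Qed.

Lemma body_area_fin : (area K < +oo)%E.
Proof.
have [M M0 KM] := body_bounded Kbody.
pose I : set (measurableTypeR R) := `[- M, M]%classic.
have mI : measurable I by exact: measurable_itv.
apply: (@le_lt_trans _ _ (mu2 (I `*` I))).
  apply: le_measure; rewrite ?inE//.
  - exact: measurable_body.
  - exact: measurableX.
  - move=> x /KM; rewrite prod_normE ge_max => /andP[x1 x2].
    by split; rewrite /I /= in_itv/= -ler_norml.
rewrite product_measure1E// [X in (X * X)%E]lebesgue_measure_itv /=.
by case: ifP => _; rewrite ?mule0// -EFinB -EFinM ltry.
Qed.

Lemma body_area_gt0 : (0 < area K)%E.
Proof.
have := body_nbhs0 Kbody Ksym; rewrite -nbhs_ballE => -[e /= e0 eK].
have mB : measurable (ball (0 : R) e : set (measurableTypeR R)).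
  exact: measurable_ball.
apply: (@lt_le_trans _ _ (mu2 (ball (0 : R) e `*` ball (0 : R) e))).
  rewrite product_measure1E// [X in (X * X)%E]lebesgue_measure_ball ?ltW//.
  by rewrite -EFinM lte_fin mulr_gt0// mulrn_wgt0.
by apply: le_measure; rewrite ?inE//;
  [exact: measurableX|exact: measurable_body].
Qed.

Lemma continuous_body_integrable (f : R * R -> R) : continuous f ->
  mu2.-integrable K (EFin \o f).
Proof.
move=> cf; have [Kcompact _] := Kbody.
apply: measurable_bounded_integrable.
- exact: measurable_body.
- exact: body_area_fin.
- by apply: measurable_funTS; exact: continuous_measurable_plane.
- have /compact_bounded[M [_ fM]] : compact (f @` K).
    by apply: continuous_compact => //; exact: continuous_subspaceT.
  exists M; split; first exact: num_real.
  by move=> C MC x Kx; apply: (fM C MC); exists x.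
Qed.

Lemma half_body_setU v : half_body K v `|` half_body K (- v) = K.
Proof.
rewrite -setIUr; apply/setIidPl => x _; rewrite /halfplane /= dotNr oppr_ge0.
by have [|/ltW] := leP 0 (dot x v); [left|right].
Qed.

Lemma half_bodyN v : half_body K (- v) = -%R @^-1` half_body K v.
Proof.
rewrite /half_body /halfplane; apply/seteqP; split=> x [Kx /= xv].
  by split; [exact: Ksym|rewrite /= dotNl -dotNr].
by split; [rewrite -[x]opprK; exact: Ksym|rewrite /= dotNr -dotNl].
Qed.

Lemma area_half_body v : v != 0 -> area (half_body K v) = (delta_star K)%:E.
Proof.
move=> v0; have mh := measurable_half_body.
have half_lty : (mu2 (half_body K v) < +oo)%E.
  apply: le_lt_trans body_area_fin; apply: le_measure; rewrite ?inE//.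
    exact: measurable_body.
  exact: half_body_subset.
have overlap0 : mu2 (half_body K v `&` half_body K (- v)) = 0%E.
  apply/eqP; rewrite eq_le measure_ge0 andbT -(measure_line v0).
  have mline : measurable ([set x | dot x v = 0] : set (plane R)).
    exact: measurable_dot_preimage (@closed_eq _ 0).
  apply: le_measure; rewrite ?inE//; first exact: measurableI.
  move=> x [[_ x0] [_]]; rewrite /halfplane /= dotNr oppr_ge0 => x1.
  by apply/eqP; rewrite eq_le x0 x1.
have areaN : mu2 (half_body K (- v)) = mu2 (half_body K v).
  by rewrite half_bodyN; exact: product_measure_oppr.
have KE : mu2 K = (mu2 (half_body K v) + mu2 (half_body K v))%E.
  rewrite -[in LHS](half_body_setU v) measureUfinl//.
  by rewrite [X in (_ - X)%E]overlap0 sube0 [X in (_ + X)%E]areaN.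
have half_fin_num : mu2 (half_body K v) \is a fin_num by rewrite ge0_fin_numE.
rewrite /delta_star /area KE fineD// -[LHS]fineK//; congr EFin.
by move: (fine _) => z; lra.
Qed.

Lemma half_momentN v : half_moment K (- v) = half_moment K v.
Proof.
rewrite /half_moment /Rintegral half_bodyN; congr fine.
rewrite -(@ge0_integral_oppr _ (half_body K v) (fun x => (dot x v)%:E)).
- by apply: eq_integral => x _; rewrite dotNl dotNr.
- exact: measurable_half_body.
- apply/measurable_EFinP/measurable_funTS.
  by apply: continuous_measurable_plane; exact: dot_continuous.
- by move=> x; rewrite inE lee_fin => -[].
Qed.

Lemma Rintegral_dot_le_half_moment (S : set (plane R)) v :
  measurable S -> S `<=` K ->
  \int[mu2]_(x in S) dot x v <= half_moment K v.
Proof.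
move=> mS SK; apply: (Rintegral_le_nonneg_part measurable_body mS SK).
by apply: continuous_body_integrable; exact: dot_continuous.
Qed.

Lemma Rintegral_dot (S : set (plane R)) v : measurable S -> S `<=` K ->
  \int[mu2]_(x in S) dot x v =
  (\int[mu2]_(x in S) x.1) * v.1 + (\int[mu2]_(x in S) x.2) * v.2.
Proof.
move=> mS SK.
have iS (f : R * R -> R) : continuous f -> mu2.-integrable S (EFin \o f).
  move=> /continuous_body_integrable.
  exact: integrableS measurable_body mS SK.
have iZ (f : R * R -> R) k : continuous f ->
    mu2.-integrable S (EFin \o (fun x => f x * k)).
  by move=> cf; apply: iS => x; apply: cvgM; [exact: cf|exact: cvg_cst].
have [c1 c2] : continuous (@fst R R) /\ continuous (@snd R R).
  by split=> x; [exact: cvg_fst|exact: cvg_snd].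
by rewrite -!RintegralZr ?RintegralD//;
  [exact: iZ|exact: iZ|exact: iS|exact: iS].
Qed.

Lemma centroid_dot (S : set (plane R)) v : measurable S -> S `<=` K ->
  dot (centroid S) v = (\int[mu2]_(x in S) dot x v) / fine (area S).
Proof.
by move=> mS SK; rewrite Rintegral_dot// {1}/dot /centroid /Rintegral /=; ring.
Qed.

Lemma delta_star_gt0 : 0 < delta_star K.
Proof. by rewrite divr_gt0// fine_gt0// body_area_gt0 body_area_fin. Qed.

Lemma Gamma_support_value v : v != 0 ->
  support_value (Gamma (delta_star K) K) v (half_moment K v / delta_star K).
Proof.
move=> v0; split=> [|_ [xi [t [_ areaS ->]]]]; last first.
  have mS : measurable (K `&` [set x | dot x xi <= t] : set (plane R)).
    by apply: measurableI; [exact: measurable_body|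
      exact: measurable_dot_preimage (@closed_le _ t)].
  have SK : K `&` [set x | dot x xi <= t] `<=` K by move=> x [].
  rewrite centroid_dot// areaS ler_pM2r ?invr_gt0 ?delta_star_gt0//.
  exact: Rintegral_dot_le_half_moment.
have [n n0 u1] := unitv_normalize v0.
have halfE : half_body K v = K `&` [set x | dot x (- (n^-1 *: v)) <= 0].
  congr (_ `&` _); apply/seteqP; split=> x;
    by rewrite /halfplane /= dotNr oppr_le0 dotZr pmulr_rge0 ?invr_gt0.
exists (centroid (half_body K v)).
  exists (- (n^-1 *: v)), 0; split; rewrite -?halfE ?area_half_body//.
  by rewrite /unitv dotNl dotNr opprK.
by rewrite centroid_dot ?area_half_body//;
  [exact: measurable_half_body|exact: half_body_subset].
Qed.

Lemma half_moment_subgradient :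
  subgradient (fun s => half_moment K (s, -1))
    (fun s => half_abscissa K (s, -1)).
Proof.
move=> s t; rewrite lerBrDr; have mh := measurable_half_body (s, -1).
have hK : half_body K (s, -1) `<=` K := @half_body_subset _.
apply: le_trans (Rintegral_dot_le_half_moment (t, -1) mh hK).
by rewrite /half_moment /half_abscissa !Rintegral_dot//=; lra.
Qed.

Lemma half_abscissa_bounded (s : R) :
  `|half_abscissa K (s, -1)| <= half_moment K (1, 0).
Proof.
have mh := measurable_half_body (s, -1).
have hK : half_body K (s, -1) `<=` K := @half_body_subset _.
have := Rintegral_dot_le_half_moment (1, 0) mh hK.
have := Rintegral_dot_le_half_moment (- (1, 0)) mh hK.
rewrite half_momentN !Rintegral_dot//= oppr0 !mulr0 !addr0 mulrN1 mulr1.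
by rewrite ler_norml lerNl => -> ->.
Qed.

Lemma half_abscissaB (s t : R) : s < t ->
  half_abscissa K (t, -1) - half_abscissa K (s, -1) =
  \int[mu2]_(x in K `&` sector s t) `|x.1|.
Proof.
move=> st; have i1 v : mu2.-integrable K (EFin \o (fst \_ (halfplane v))).
  apply: integrable_patch; first exact: measurable_body.
    exact: measurable_halfplane.
  by apply: continuous_body_integrable => x; exact: cvg_fst.
rewrite /half_abscissa !Rintegral_mkcondr -RintegralB//;
  last exact: measurable_body.
apply: eq_Rintegral => x _; rewrite !patchE in_sector !in_halfplane /dot /=.
have [xs|xs] := leP 0 (x.1 * s + _); have [xt|xt] := leP 0 (x.1 * t + _) => /=.
- by rewrite subrr.
- have : 0 < - x.1 * (t - s) by lra.
  by rewrite pmulr_lgt0 ?subr_gt0// oppr_gt0 => /ltr0_norm ->; rewrite sub0r.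
- have : 0 < x.1 * (t - s) by lra.
  by rewrite pmulr_lgt0 ?subr_gt0// => /gtr0_norm ->; rewrite subr0.
- by rewrite subrr.
Qed.

Lemma half_abscissa_increment_bounds (s t a b : R) : s < t -> 0 < a ->
  (forall m, s <= m <= t -> a <= radial K (1, m) <= b) ->
  2 / 3 * a ^+ 3 * (t - s) <=
    half_abscissa K (t, -1) - half_abscissa K (s, -1) <=
  2 / 3 * b ^+ 3 * (t - s).
Proof.
move=> st a0 rab; have ab : a <= b.
  have /rab/andP[ra rb] : s <= s <= t by rewrite lexx ltW.
  exact: le_trans ra rb.
have mKs : measurable (K `&` sector s t : set (plane R)).
  by apply: measurableI; [exact: measurable_body|exact: measurable_sector].
have mstrip (c : R) :
    measurable ([set x | `|x.1| <= c] `&` sector s t : set (plane R)).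
  by apply: measurableI; [exact: measurable_strip|exact: measurable_sector].
have fst_cont : continuous (fun x : R * R => `|x.1|).
  by move=> x; apply: (@cvg_norm _ R); exact: cvg_fst.
have le_int (A B : set (plane R)) : measurable A -> measurable B -> A `<=` B ->
    (\int[mu2]_(x in A) `|x.1|%:E <= \int[mu2]_(x in B) `|x.1|%:E)%E.
  move=> mA mB; apply: ge0_subset_integral => //.
  apply/measurable_EFinP/measurable_funTS.
  exact: (continuous_measurable_plane fst_cont).
have fin : (\int[mu2]_(x in K `&` sector s t) `|x.1|%:E \is a fin_num)%E.
  apply: integrable_fin_num => //; apply: integrableS measurable_body mKs _ _.
    by move=> x [].
  exact: continuous_body_integrable fst_cont.
have -> : t - s = `|s - t| by rewrite ltr0_norm ?subr_lt0// opprB.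
have b0 : 0 < b := lt_le_trans a0 ab.
rewrite half_abscissaB// -!lee_fin fineK// -!integral_strip_sector//.
apply/andP; split; apply: le_int => // x [+ xst]; split=> //.
- have [x10 /rab/andP[ra _]] := sector_slope st xst.
  by apply/(body_slopeP Kbody Ksym) => //; exact: le_trans ra.
- have [x10 /rab/andP[_ rb]] := sector_slope st xst.
  by apply: le_trans rb; exact/(body_slopeP Kbody Ksym).
Qed.

End half_bodies.

Section homothetic_curves.
Context {R : realType} (K : set (R * R)).
Hypothesis Kbody : convex_body K.
Hypothesis Ksym : origin_symmetric K.

(* Averaging over [v] and [- v] removes the centre of the homothety. *)
Lemma homothetic_half_moment :
  homothetic (Gamma (delta_star K) K) (bd (Istar K)) ->
  exists2 B : R, 0 < B &
    forall v : R * R, v != 0 -> half_moment K v * radial K (perp v) = B.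
Proof.
move=> /homothetic_support_value[q [lam lam0 supportE]].
have d0 := delta_star_gt0 Kbody Ksym.
exists (lam * delta_star K / 2) => [|v v0].
  by rewrite divr_gt0// mulr_gt0.
have momentE w : w != 0 -> half_moment K w / delta_star K =
    (1 - lam) * dot q w + lam * (2 * radial K (perp w))^-1.
  move=> w0; apply: support_value_unique (Gamma_support_value Kbody Ksym w0) _.
  exact/supportE/bd_Istar_support_value.
have := momentE _ v0; have := momentE (- v); rewrite oppr_eq0 => /(_ v0).
rewrite half_momentN// dotNr perpN radialN//.
have [r0 _] := radialP Kbody Ksym (perp_neq0 v0) => eqN eqv.
have {eqN eqv} : half_moment K v / delta_star K =
    lam * (2 * radial K (perp v))^-1 by lra.
move=> /(congr1 (fun z => z * delta_star K * radial K (perp v))).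
by rewrite divfK ?gt_eqF// => ->; field; rewrite gt_eqF.
Qed.

Lemma half_moment_continuous : continuous (fun s => half_moment K (s, -1)).
Proof.
exact: bounded_subgradient_continuous (half_moment_subgradient Kbody)
  (half_abscissa_bounded Kbody Ksym).
Qed.

Lemma half_abscissa_is_derive (s : R) : continuous (fun m => radial K (1, m)) ->
  is_derive s 1 (fun m => half_abscissa K (m, -1))
    (2 / 3 * radial K (1, s) ^+ 3).
Proof.
move=> cr; pose f m := 2 / 3 * radial K (1, m) ^+ 3.
apply: (is_derive_increment_bounds (f := f)).
  move=> {}s t st; have crst := continuous_subspaceT cr.
  have [m + minm] := EVT_min (ltW st) (crst _).
  have [M + maxM] := EVT_max (ltW st) (crst _).
  rewrite !in_itv /= => Mst mst; exists m, M; split=> //.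
  have [rm0 _] := radialP Kbody Ksym (slope_neq0 m).
  apply: half_abscissa_increment_bounds => // z zst.
  by rewrite minm ?maxM ?in_itv.
apply: cvgM; first exact: cvg_cst.
by apply: cvgM; [exact: cr|apply: cvgM; exact: cr].
Qed.

Lemma radial_inv_sqr_quadratic (B : R) : 0 < B ->
  (forall v : R * R, v != 0 -> half_moment K v * radial K (perp v) = B) ->
  exists a b c : R,
    forall m, (radial K (1, m))^-1 ^+ 2 = a * m ^+ 2 + b * m + c.
Proof.
move=> B0 BE; pose M s := half_moment K (s, -1); pose r m := radial K (1, m).
have Mr m : M m * r m = B.
  rewrite -(BE (m, -1)) /perp /= ?opprK//.
  by rewrite xpair_eqE oppr_eq0 oner_eq0 andbF.
have r0 m : 0 < r m by have [] := radialP Kbody Ksym (slope_neq0 m).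
have M0 m : 0 < M m by rewrite -(pmulr_lgt0 _ (r0 m)) Mr.
have rE m : r m = B / M m by rewrite -(Mr m) mulrC mulKf// gt_eqF.
have cr : continuous r.
  rewrite (_ : r = fun m => B / M m); last exact/funext.
  move=> m; apply: cvgM; first exact: cvg_cst.
  by apply: cvgV; [rewrite gt_eqF|exact: half_moment_continuous].
have dN := fun s => half_abscissa_is_derive s cr.
have dM (s : R) : is_derive s 1 M (half_abscissa K (s, -1)).
  apply: (subgradient_is_derive (half_moment_subgradient Kbody)).
  by apply/differentiable_continuous/derivable1_diffP; have [] := dN s.
have [|s|a [b [c ME]]] := ermakov_square_quadratic (C := 2 / 3 * B ^+ 3) _ dM.
- by move=> s; rewrite gt_eqF.
- by apply: is_derive_eq (dN s) _; rewrite -/(r s) rE; field; rewrite gt_eqF.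
exists (a / B ^+ 2), (b / B ^+ 2), (c / B ^+ 2) => m.
by rewrite -/(r m) rE invf_div expr_div_n ME; field; rewrite gt_eqF.
Qed.

End homothetic_curves.

Section ellipses.
Context {R : realType}.

Definition quadratic_form (a b c : R) (x : R * R) : R :=
  a * x.2 ^+ 2 + b * x.1 * x.2 + c * x.1 ^+ 2.

Definition quadratic_sublevel (a b c : R) : set (R * R) :=
  [set x | quadratic_form a b c x <= 1].

Lemma closed_convex_subset_off_axis (A B : set (R * R)) :
  convex_set2 A -> closed B -> (exists2 p, A p & p.1 != 0) ->
  (forall x, x.1 != 0 -> A x -> B x) -> A `<=` B.
Proof.
move=> Aconv Bclosed [p Ap p1] AB x Ax.
have [x1|/AB] := eqVneq x.1 0; last exact.
have : (t *: p + (1 - t) *: x) @[t --> (0 : R)^'+] --> x.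
  apply: cvg_at_right_filter.
  rewrite (_ : nbhs x = nbhs (0 *: p + (1 - 0) *: x)); last first.
    by rewrite scale0r add0r subr0 scale1r.
  apply: cvgD; apply: cvgZr_tmp; first exact: cvg_id.
  by apply: cvgB; [exact: cvg_cst|exact: cvg_id].
apply: closed_cvg => //; near=> t; apply: AB.
  by rewrite !scale_pairE /= x1 mulr0 addr0 mulf_neq0// gt_eqF.
by apply: Aconv => //; apply/andP; split; exact: ltW.
Unshelve. all: by end_near. Qed.

Lemma coercive_quadratic_definite (a b c e : R) : 0 < e ->
  (forall m, e * (1 + m ^+ 2) <= a * m ^+ 2 + b * m + c) ->
  0 < a /\ b ^+ 2 < 4 * a * c.
Proof.
move=> e0 coercive; have ec : e <= c by have := coercive 0; lra.
have a0 : 0 < a.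
  rewrite ltNge; apply/negP => a_le0; have ea : 0 < e - a by lra.
  pose u := (c - e) / (e - a).
  have u0 : 0 <= u by rewrite divr_ge0 ?subr_ge0// ltW// -subr_gt0.
  have uE : u * (e - a) = c - e by rewrite divfK// gt_eqF.
  have : 0 <= u ^+ 2 * (e - a) by rewrite mulr_ge0 ?sqr_ge0// ltW.
  have := coercive (1 + u); have := coercive (- (1 + u)); lra.
split=> //; rewrite -subr_gt0.
have := coercive (- b / (2 * a)).
rewrite (_ : _ + c = (4 * a * c - b ^+ 2) / (4 * a)); last first.
  by field; rewrite gt_eqF.
rewrite ler_pdivlMr ?mulr_gt0//; apply: lt_le_trans.
by rewrite !mulr_gt0// ltr_pwDl// sqr_ge0.
Qed.

Lemma quadratic_sublevel_closed (a b c : R) : closed (quadratic_sublevel a b c).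
Proof.
apply: (@preimage_closed _ _ (quadratic_form a b c) [set t | t <= 1]);
  last exact: closed_le.
move=> x _; have c1 : fst @ x --> x.1 by exact: cvg_fst.
have c2 : snd @ x --> x.2 by exact: cvg_snd.
apply: cvgD; [apply: cvgD|]; apply: cvgM => //.
- exact: cvg_cst.
- exact: cvgM.
- by apply: cvgM => //; exact: cvg_cst.
- exact: cvg_cst.
- exact: cvgM.
Qed.

Section definite_forms.
Variables a b c : R.
Hypotheses (a0 : 0 < a) (disc : b ^+ 2 < 4 * a * c).

Let reduced_gt0 : 0 < c - b ^+ 2 / (4 * a).
Proof. by rewrite subr_gt0 ltr_pdivrMr ?mulr_gt0// mulrC. Qed.

Lemma quadratic_form_complete_square x : quadratic_form a b c x =
  a * (x.2 + b / (2 * a) * x.1) ^+ 2 + (c - b ^+ 2 / (4 * a)) * x.1 ^+ 2.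
Proof. by rewrite /quadratic_form; field; rewrite gt_eqF. Qed.

Lemma quadratic_form_ge0 x : 0 <= quadratic_form a b c x.
Proof.
by rewrite quadratic_form_complete_square addr_ge0// mulr_ge0 ?sqr_ge0// ltW.
Qed.

Lemma quadratic_sublevel_convex : convex_set2 (quadratic_sublevel a b c).
Proof.
pose Q := quadratic_form a b c.
move=> x y t; rewrite /quadratic_sublevel /= -!/(Q _) => x1 y1 /andP[t0 t1].
have -> : Q (t * x.1 + (1 - t) * y.1, t * x.2 + (1 - t) * y.2) =
    t * Q x + (1 - t) * Q y - t * (1 - t) * Q (x - y).
  by rewrite /Q /quadratic_form /=; ring.
have : 0 <= t * (1 - t) * Q (x - y).
  by rewrite !mulr_ge0 ?quadratic_form_ge0// subr_ge0.
have : t * Q x <= t by rewrite ler_piMr.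
have : (1 - t) * Q y <= 1 - t by rewrite ler_piMr// subr_ge0.
lra.
Qed.

Lemma quadratic_sublevel_is_ellipse : is_ellipse (quadratic_sublevel a b c).
Proof.
pose d := Num.sqrt (c - b ^+ 2 / (4 * a)); pose e := Num.sqrt a.
pose k := b / (2 * a).
have [d0 e0] : 0 < d /\ 0 < e by rewrite !sqrtr_gt0.
have QE x : quadratic_form a b c x =
    (e * (x.2 + k * x.1)) ^+ 2 + (d * x.1) ^+ 2.
  by rewrite quadratic_form_complete_square !exprMn !sqr_sqrtr// ltW.
exists (0, 0), d^-1, 0, (- k / d), e^-1; split.
  by rewrite mul0r subr0 mulf_neq0// invr_eq0 gt_eqF.
apply/seteqP; split=> [x|_ [z /= z1 <-]]; rewrite /quadratic_sublevel /= QE.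
- move=> x1; exists (d * x.1, e * (x.2 + k * x.1)); first by rewrite /= addrC.
  by rewrite [RHS]surjective_pairing; congr pair => /=; field; rewrite ?gt_eqF.
- apply: le_trans z1; rewrite le_eqVlt; apply/orP; left; apply/eqP => /=.
  by field; rewrite !gt_eqF.
Qed.

End definite_forms.

Lemma radial_quadratic_is_ellipse (K : set (R * R)) (a b c : R) :
  convex_body K -> origin_symmetric K ->
  (forall m, (radial K (1, m))^-1 ^+ 2 = a * m ^+ 2 + b * m + c) ->
  is_ellipse K.
Proof.
move=> Kbody Ksym rQ; have [_ [Kconv _]] := Kbody.
have KQ x : x.1 != 0 -> K x <-> quadratic_sublevel a b c x.
  move=> x10; have [r0 _] := radialP Kbody Ksym (slope_neq0 (x.2 / x.1)).
  have QE : quadratic_form a b c x = (`|x.1| / radial K (1, x.2 / x.1)) ^+ 2.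
    by rewrite exprMn rQ real_normK ?num_real// /quadratic_form; field.
  rewrite (body_slopeP Kbody Ksym)// /quadratic_sublevel /= QE expr_le1//.
    by rewrite ler_pdivrMr// mul1r.
  by rewrite divr_ge0// ltW.
have [e e0 coercive] := radial_inv_sqr_coercive Kbody Ksym.
have [|a0 disc] := @coercive_quadratic_definite a b c e e0.
  by move=> m; rewrite -rQ.
have [p Kp p0] : exists2 p, K p & p.1 != 0.
  have [t t0] := nbhs_ray (1, 0) (body_nbhs0 Kbody Ksym).
  rewrite add0r scale_pairE /= mulr1 => Kt.
  by exists (t, t * 0); rewrite //= gt_eqF.
suff -> : K = quadratic_sublevel a b c by exact: quadratic_sublevel_is_ellipse.
apply/seteqP; split; apply: closed_convex_subset_off_axis => //.
- exact: quadratic_sublevel_closed.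
- by exists p.
- by move=> x /KQ[].
- exact: quadratic_sublevel_convex.
- exact: body_closed.
- by exists p => //; apply/KQ.
- by move=> x /KQ[].
Qed.

End ellipses.

Theorem theorem4p11 (R : realType) (K : set (R * R)) :
  convex_body K -> origin_symmetric K -> C2_boundary K ->
  homothetic (Gamma (delta_star K) K) (bd (Istar K)) ->
  is_ellipse K.
Proof.
move=> Kbody Ksym _ /(homothetic_half_moment Kbody Ksym)[B B0 momentE].
have [a [b [c rQ]]] := radial_inv_sqr_quadratic Kbody Ksym B0 momentE.
exact: radial_quadratic_is_ellipse rQ.
Qed.
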